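(* For every nonnegative integer $n$, $$p(n)=\sum_{j=0}^{\infty}pod(j)\,P_2'(n-j).$$
   Context: $p(n)$ denotes the number of (unrestricted) partitions of $n$, with $p(0)=1$. $pod(n)$ denotes the number of partitions of $n$ in which odd parts are distinct and even parts may be repeated, with $pod(0)=1$. $P_2'(n)$ denotes the number of partitions of $n$ into parts congruent to $2\pmod 4$, with $P_2'(0)=1$ and $P_2'(m)=0$ for $m<0$. *)

(* Defs.v *)
From mathcomp Require Import all_boot all_order all_algebra.
From mathcomp Require Import all_classical all_reals all_analysis.

Set Implicit Arguments.
Unset Strict Implicit.
Unset Printing Implicit Defensive.

(* Nonincreasing sequences of positive integers with sum [n]. *)
Definition is_partition (n : nat) (s : seq nat) : bool :=
  [&& sorted geq s, 0 \notin s & sumn s == n].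

(* A partition of [n] has at most [n] parts, each at most [n], so it is a
   sequence of length at most [n] over ['I_n.+1]; see [is_partition_bseq]. *)
Definition count_partitions (P : pred (seq nat)) (n : nat) : nat :=
  #|[set t : n.-bseq 'I_n.+1 |
      let s := [seq val i | i <- t] in is_partition n s && P s]|.

Lemma is_partition_bseq (n : nat) (s : seq nat) :
  is_partition n s -> exists t : n.-bseq 'I_n.+1, [seq val i | i <- t] = s.
Proof.
case/and3P=> _ s_pos /eqP <-.
have le_size : size s <= sumn s.
  elim: s s_pos => //= x s IHs; rewrite inE negb_or eq_sym -lt0n.
  by case/andP=> x_gt0 /IHs; rewrite -add1n; apply: leq_add.
have le_sum : all (fun i => i < (sumn s).+1) s.
  apply/allP=> i; elim: (s) => //= x u IHu; rewrite inE ltnS.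
  case/predU1P=> [->|/IHu]; first exact: leq_addr.
  by rewrite ltnS => /leq_trans; apply; exact: leq_addl.
have E : [seq val i | i <- [seq (inord i : 'I_(sumn s).+1) | i <- s]] = s.
  rewrite -map_comp -[RHS]map_id; apply/eq_in_map => i /(allP le_sum) lti /=.
  by rewrite inordK.
have szE : size [seq (inord i : 'I_(sumn s).+1) | i <- s] <= sumn s.
  by rewrite size_map.
by exists (Bseq szE).
Qed.

Definition p (n : nat) : nat := count_partitions predT n.

Definition pod (n : nat) : nat :=
  count_partitions (fun s => uniq [seq i <- s | odd i]) n.

Definition P2' (m : int) : nat :=
  match m with
  | Posz k => count_partitions (all (fun i => i %% 4 == 2)) k
  | Negz _ => 0
  end.

(* Main.v *)
(* The identity is bijective: if an odd part x occurs e + 2m times in a partition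
   of n, with e in {0, 1}, keep e copies of x and trade the other 2m copies for m
   parts equal to 2x. The even parts and the kept odd parts form a partition with
   distinct odd parts, and the parts 2x are exactly those congruent to 2 mod 4.
   This is (1 + q^x) / (1 - q^(2x)) = 1 / (1 - q^x), for odd x, on generating
   functions. *)
Require Import Defs.
From mathcomp Require Import all_boot all_order all_algebra.
From mathcomp Require Import all_classical all_reals all_analysis.
From mathcomp Require Import zify.

Set Implicit Arguments.
Unset Strict Implicit.
Unset Printing Implicit Defensive.

(** Plain lists drop the bounds depending on [n] from the types, so partitions of different numbers
    can be paired and compared directly. *)
Definition partitions (n : nat) : seq (seq nat) :=
  [seq s <- [seq [seq val i | i <- val t] | t : n.-bseq 'I_n.+1]
  | is_partition n s].

Lemma mem_partitions n s : (s \in partitions n) = is_partition n s.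
Proof.
rewrite mem_filter andb_idr // => /is_partition_bseq[t <-].
by apply/mapP; exists t; rewrite ?mem_enum.
Qed.

Lemma mem_filter_partitions (P : pred (seq nat)) n s :
  (s \in [seq t <- partitions n | P t]) = P s && is_partition n s.
Proof. by rewrite mem_filter mem_partitions. Qed.

Lemma partitions_uniq n : uniq (partitions n).
Proof.
apply: filter_uniq; rewrite map_inj_uniq ?enum_uniq // => t u /= tu.
by apply/val_inj/(inj_map val_inj).
Qed.

Lemma count_partitionsE (P : pred (seq nat)) n :
  count_partitions P n = size [seq s <- partitions n | P s].
Proof.
rewrite /count_partitions cardsE cardE /enum_mem /partitions -filter_predI.
rewrite filter_map size_map enumT; congr (size _); apply: eq_filter => t /=.
by rewrite andbC.
Qed.

Lemma geq_trans : transitive geq.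
Proof. by move=> b a c /= ba cb; apply: leq_trans ba. Qed.

Lemma geq_antisym : antisymmetric geq.
Proof. by move=> a b /=; rewrite -eqn_leq => /eqP. Qed.

Lemma geq_total : total geq.
Proof. by move=> a b; apply: leq_total. Qed.

(** The trade run backwards: each part 2x of the second component becomes two copies of x again. *)
Definition glue (ab : seq nat * seq nat) : seq nat :=
  sort geq (ab.1 ++ map half ab.2 ++ map half ab.2).

Definition odd_uniq (s : seq nat) := uniq [seq i <- s | odd i].

Definition all_2mod4 (s : seq nat) := all (fun i => i %% 4 == 2) s.

Lemma all_2mod4_mem s x : all_2mod4 s -> x \in s -> (x %% 4 = 2).
Proof. by move=> /allP h /h /eqP. Qed.

Lemma count_half s x : all_2mod4 s ->
  count_mem x (map half s) = count_mem x.*2 s.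
Proof.
move=> /allP s2; rewrite count_map; apply: eq_in_count => y /s2 /eqP y2 /=.
by apply/eqP/eqP; lia.
Qed.

Lemma count_glue a b x : all_2mod4 b ->
  count_mem x (glue (a, b)) = (count_mem x a + (count_mem x.*2 b).*2).
Proof.
move=> b2; rewrite /glue (permP (permEl (perm_sort _ _))) !count_cat /=.
by rewrite count_half // addnn.
Qed.

Lemma sumn_half s : all_2mod4 s -> ((sumn (map half s)).*2 = sumn s).
Proof. by elim: s => //= x s IH /andP[/eqP x2 /IH]; lia. Qed.

Lemma glue_partition a b m k : is_partition m a -> is_partition k b ->
  all_2mod4 b -> is_partition (m + k) (glue (a, b)).
Proof.
case/and3P=> _ a0 /eqP <- /and3P[_ b0 /eqP <-] b2; apply/and3P; split.
- exact: (sort_sorted geq_total).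
- rewrite mem_sort !mem_cat (negPf a0) /= orbb; apply/mapP => -[x xb].
  by have := all_2mod4_mem b2 xb; lia.
- rewrite (perm_sumn (permEl (perm_sort _ _))) !sumn_cat addnn.
  by rewrite sumn_half.
Qed.

Lemma odd_uniq_count s x : odd_uniq s -> odd x -> (count_mem x s <= 1).
Proof.
move=> /count_uniq_mem cu ox; have := cu x; rewrite count_filter.
rewrite (eq_count (a2 := pred1 x)); first by move=> ->; case: (_ \in _).
by move=> y /=; case: eqP => // ->.
Qed.

(** A sorted list is determined by its multiplicities, and [count_glue] recovers these. For odd x,
    the multiplicity of x in [a] is at most 1, so it is the parity of the multiplicity in the glued
    list. For even x, 2x is divisible by 4 and does not occur in [b]. *)
Lemma glue_inj a b a' b' : sorted geq a -> sorted geq a' ->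
    sorted geq b -> sorted geq b' -> odd_uniq a -> odd_uniq a' ->
    all_2mod4 b -> all_2mod4 b' ->
  glue (a, b) = glue (a', b') -> (a, b) = (a', b').
Proof.
move=> sa sa' sb sb' ua ua' b2 b2' E.
have C x : (count_mem x a + (count_mem x.*2 b).*2 =
            count_mem x a' + (count_mem x.*2 b').*2).
  by rewrite -!count_glue // E.
have Z s x : all_2mod4 s -> (x %% 4 != 2) -> count_mem x s = 0.
  move=> s2 x2; apply/count_memPn/negP => /(all_2mod4_mem s2) xs.
  by rewrite xs in x2.
have Cab x : count_mem x a = count_mem x a' /\
             count_mem x.*2 b = count_mem x.*2 b'.
  have Cx := C x; have [ox|ex] := boolP (odd x).
    have := odd_uniq_count ua ox; have := odd_uniq_count ua' ox; lia.
  have nx : (x.*2 %% 4 != 2) by lia.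
  by rewrite !(Z _ _ _ nx) // in Cx *; split=> //; lia.
congr (_, _); apply: (sorted_eq geq_trans geq_antisym) => //.
  by apply/allP => x _ /=; apply/eqP; case: (Cab x).
apply/allP => x _ /=; apply/eqP.
(* [Cab] only reaches even entries of [b], which suffices: all parts there are 2 mod 4. *)
have [x2|x2] := eqVneq (x %% 4) 2; last by rewrite !Z.
have -> : x = (x./2).*2 by lia.
by case: (Cab x./2).
Qed.

(* Adding parts one at a time: a second copy of an odd part x of the first
   component is removed from it, together with x, and 2x goes to the second. *)
Lemma glue_decomposition s : exists a b,
  [/\ odd_uniq a, all_2mod4 b & perm_eq s (a ++ map half b ++ map half b)].
Proof.
elim: s => [|x s [a [b [ua b2 sab]]]]; first by exists [::], [::].
have [/andP[ox xa]|h] := boolP (odd x && (x \in a)).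
  exists (rem x a), (x.*2 :: b); split.
  - rewrite /odd_uniq; apply: subseq_uniq ua.
    by rewrite subseq_filter filter_all /= (subseq_trans (filter_subseq _ _))
      ?rem_subseq.
  - by rewrite /all_2mod4 /= -/(all_2mod4 b) b2 andbT; apply/eqP; lia.
  - rewrite /= doubleK.
    apply: (@perm_trans _ (x :: (a ++ map half b ++ map half b))).
      by rewrite perm_cons.
    apply/permP => q; have := permP (perm_to_rem xa) q.
    by rewrite /= !count_cat /= !count_cat /=; lia.
(* Now x is even or absent from [a], so adding it keeps the odd parts distinct. *)
exists (x :: a), b; split=> //; last by rewrite /= perm_cons.
rewrite /odd_uniq /=; case: ifP h => //= ox xa.
by rewrite mem_filter ox xa.
Qed.

Lemma glue_surj n s : is_partition n s -> exists a b,
  [/\ is_partition (sumn a) a, odd_uniq a, is_partition (n - sumn a) b,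
      all_2mod4 b & (sumn a <= n) /\ glue (a, b) = s].
Proof.
case/and3P=> ss s0 /eqP <-.
have [a0 [b0 [ua b2 sab]]] := glue_decomposition s.
have sortP t := permEl (perm_sort geq t).
have b2' : all_2mod4 (sort geq b0) by rewrite /all_2mod4 (perm_all _ (sortP _)).
have sumE : sumn s = (sumn a0 + sumn b0).
  by rewrite (perm_sumn sab) !sumn_cat addnn sumn_half.
have := s0; rewrite (perm_mem sab) !mem_cat negb_or => /andP[a0z b0z].
exists (sort geq a0), (sort geq b0).
rewrite (perm_sumn (sortP _)) sumE addKn leq_addr; split=> //.
- by apply/and3P; rewrite (sort_sorted geq_total) mem_sort (perm_sumn (sortP _)).
- by rewrite /odd_uniq (perm_uniq (perm_filter _ (sortP _))).
- apply/and3P; rewrite (sort_sorted geq_total) mem_sort (perm_sumn (sortP _)).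
  (* [b0z] concerns the halves only; 0 is not a part of [b0] because it is not 2 mod 4. *)
  by split=> //; apply/negP => /(all_2mod4_mem b2).
- split=> //; apply: (sorted_eq geq_trans geq_antisym) => //.
    exact: (sort_sorted geq_total).
  apply/permP => q; rewrite (permP (sortP _)) (permP sab) /= !count_cat.
  by rewrite !count_map !(permP (sortP _)).
Qed.

Lemma p_convolution n :
  p n = (\sum_(0 <= j < n.+1) pod j * P2' (n - j)%N).
Proof.
rewrite /p /pod /P2' count_partitionsE filter_predT.
pose pods j := [seq s <- partitions j | odd_uniq s].
pose evens j := [seq s <- partitions j | all_2mod4 s].
pose pairs j := [seq (a, b) | a <- pods j, b <- evens (n - j)].
pose L := [seq ab | j <- iota 0 n.+1, ab <- pairs j].
have mem_L a b : (a, b) \in L -> [/\ is_partition (sumn a) a, odd_uniq a,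
    is_partition (n - sumn a) b, all_2mod4 b & (sumn a <= n)].
  case/allpairsPdep=> j [_ [jn /allpairsP[[a' b'] /= [ha hb ->]] [-> ->]]].
  move: jn ha hb; rewrite mem_iota /pods /evens !mem_filter_partitions.
  move=> jn /andP[ua pa] /andP[b2 pb].
  by have/and3P[_ _ /eqP ->] := pa.
have -> : (\sum_(0 <= j < n.+1) count_partitions
    (fun s => uniq [seq i <- s | odd i]) j *
    count_partitions (all (fun i => i %% 4 == 2)) (n - j) = size L).
  rewrite /L size_allpairs_dep sumnE big_map /index_iota subn0.
  by apply: eq_bigr => j _; rewrite size_allpairs !count_partitionsE.
have L_uniq : uniq L.
  apply: allpairs_uniq_dep.
  - exact: iota_uniq.
  - move=> j _; apply: allpairs_uniq; last by move=> [? ?] [? ?].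
      exact/filter_uniq/partitions_uniq.
    exact/filter_uniq/partitions_uniq.
  (* The slices of [L] are disjoint: a pair (a, b) lies only in the slice whose index is the sum of
     [a]. *)
  - move=> _ _ /allpairsPdep[j [ab [_ hab ->]]] /allpairsPdep[k [cd [_ hcd ->]]].
    move=> /= E; rewrite E in hab *; congr existT.
    move: hab hcd; case: cd {E} => c d.
    case/allpairsP=> -[c1 d1] /= [h1 _ [E1 _]].
    case/allpairsP=> -[c2 d2] /= [h2 _ [E2 _]].
    move: h1 h2; rewrite -E1 -E2 /pods !mem_filter_partitions.
    by case/and4P=> _ _ _ /eqP <- /and4P[_ _ _ /eqP].
(* Both lists are duplicate-free, so it remains to see that [glue] sends [L] exactly onto the
   partitions of [n]. *)
rewrite -(size_map glue L); apply/perm_size/uniq_perm.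
- exact: partitions_uniq.
- rewrite map_inj_in_uniq // => -[a b] [a' b'].
  move=> /mem_L[/andP[sa _] ua /andP[sb _] b2 _].
  move=> /mem_L[/andP[sa' _] ua' /andP[sb' _] b2' _].
  exact: glue_inj.
move=> s; rewrite mem_partitions; apply/idP/mapP.
  case/glue_surj=> a [b [pa ua pb b2 [an <-]]]; exists (a, b) => //.
  apply/allpairsPdep; exists (sumn a), (a, b); rewrite mem_iota ltnS an.
  split=> //; apply/allpairsP; exists (a, b) => /=.
  by rewrite /pods /evens !mem_filter_partitions ua b2.
case=> -[a b] /mem_L[pa _ pb b2 an] ->.
by rewrite -(subnKC an) glue_partition.
Qed.

Local Open Scope ring_scope.
Local Open Scope ereal_scope.

(** Subtraction is in the integers: truncated subtraction would give [P2'] the value 1 at every j >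
    n, and the series would diverge. *)
Theorem theorem4p10 (R : realType) (n : nat) :
  ((p n)%:R : R)%:E =
  \sum_(0 <= j <oo) ((pod j * P2' (n%:Z - j%:Z)%R)%N%:R : R)%:E.
Proof.
rewrite (nneseries_split 0 n.+1) ?add0n; last by move=> k _; rewrite lee_fin.
(* The tail from n + 1 on vanishes, since [P2'] is 0 at negative integers. *)
rewrite eseries0 ?adde0; last first.
  move=> j nj _; have : (n%:Z - j%:Z < 0)%R by lia.
  by case: (n%:Z - j%:Z)%R => // k _; rewrite muln0.
rewrite p_convolution GRing.natr_sum -sumEFin; apply: eq_big_nat => j /andP[_ jn].
by rewrite subzn.
Qed.
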